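(* Let $k$ be a positive integer and let $G$ be a sun-free chordal graph. Then $\gamma_k(G)=\rho_k(G)$ if and only if $\rho_k(G)=\rho_{2k}(G)$.
   Context: Graphs are finite, simple. A $k$-packing is a set of vertices with pairwise distances larger than $k$; $\rho_k(G)$ is the maximum size of a $k$-packing. A $k$-domination set is a set $D$ such that every vertex is at distance at most $k$ from some vertex of $D$; $\gamma_k(G)$ is the minimum size of a $k$-domination set. A sun is a chordal graph whose vertex set can be partitioned into $X=\{x_1,\dots,x_n\}$ and $Y=\{y_1,\dots,y_n\}$ such that $X$ is independent, $y_iy_{i+1}\in E$ for $1\le i\le n-1$ and $y_ny_1\in E$, and $x_iy_j\in E$ iff $i=j$ or $i=j+1$ or ($i=n$, $j=1$). A chordal graph is sun-free chordal if it contains no sun as an induced subgraph. *)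

(* Defs.v *)
From mathcomp Require Import all_boot.

Set Implicit Arguments.
Unset Strict Implicit.
Unset Printing Implicit Defensive.

(* A finite simple graph is a symmetric irreflexive relation [e : rel T] on a
   finite type [T]; it is not assumed to be connected. *)

Definition walk (T : finType) (e : rel T) (n : nat) (x y : T) : bool :=
  [exists p : n.-tuple T, path e x p && (last x p == y)].

(* [None] is the infinite distance between different components.  A shortest
   walk between connected vertices repeats no vertex, so that its length is
   less than [#|T|] and the search below succeeds. *)
Definition dist (T : finType) (e : rel T) (x y : T) : option nat :=
  if connect e x y then Some (find (fun n => walk e n x y) (iota 0 #|T|))
  else None.

Definition dist_le (T : finType) (e : rel T) (k : nat) (x y : T) : bool :=
  if dist e x y is Some d then d <= k else false.

Lemma walkP (T : finType) (e : rel T) n x y :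
  reflect (exists p : seq T, [/\ path e x p, last x p = y & size p = n])
          (walk e n x y).
Proof.
apply: (iffP existsP) => [[p /andP[ep /eqP lp]]|[p [ep lp sp]]].
  by exists p; rewrite size_tuple.
have sp' : size p == n by apply/eqP.
by exists (Tuple sp'); rewrite /= ep lp eqxx.
Qed.

Lemma dist_leP (T : finType) (e : rel T) k x y :
  reflect (exists p : seq T, [/\ path e x p, last x p = y & size p <= k])
          (dist_le e k x y).
Proof.
rewrite /dist_le /dist; set a := fun n => walk e n x y.
have short p : path e x p -> last x p = y ->
    exists2 m, m < #|T| & (m <= size p) && a m.
  move=> ep; case/shortenP: ep => q eq uq sq lq.
  exists (size q).
    by rewrite -(card_uniqP uq : _ = (size q).+1) max_card.
  have uq' : uniq q by case/andP: uq.
  by rewrite (uniq_leq_size uq') //=; apply/walkP; exists q.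
have find_le m : m < #|T| -> a m -> find a (iota 0 #|T|) <= m.
  move=> mT am; rewrite leqNgt; apply/negP => lt.
  by have := before_find 0 lt; rewrite nth_iota // add0n am.
case: ifP => [exy|nc]; last first.
  constructor=> -[p [ep lp _]]; move/negP: nc; apply.
  by apply/connectP; exists p.
apply: (iffP idP) => [le_k|[q [eq lq sq]]]; last first.
  have [j jT /andP[jq aj]] := short q eq lq.
  exact: leq_trans (find_le j jT aj) (leq_trans jq sq).
have [p ep lp] := connectP exy.
have [m mT /andP[_ am]] := short p ep (esym lp).
have has_a : has a (iota 0 #|T|).
  by apply/hasP; exists m; rewrite // mem_iota.
have lt_f : find a (iota 0 #|T|) < #|T|.
  by have := has_a; rewrite has_find size_iota.
have := nth_find 0 has_a; rewrite nth_iota // add0n => /walkP[q [eq lq sq]].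
by exists q; rewrite sq.
Qed.

Definition packing (T : finType) (e : rel T) (k : nat) (S : {set T}) : bool :=
  [forall x in S, forall y in S, (x != y) ==> ~~ dist_le e k x y].

Definition rho (T : finType) (e : rel T) (k : nat) : nat :=
  \max_(S : {set T} | packing e k S) #|S|.

Definition dominating (T : finType) (e : rel T) (k : nat)
    (D : {set T}) : bool :=
  [forall x, exists y in D, dist_le e k x y].

(* The default [setT] is [k]-dominating, so this is a genuine minimum. *)
Definition gamma (T : finType) (e : rel T) (k : nat) : nat :=
  #|[arg min_(D < [set: T] | dominating e k D) #|D|]|.

Lemma dominating_setT (T : finType) (e : rel T) k : dominating e k [set: T].
Proof.
apply/forallP => x; apply/existsP; exists x; rewrite inE.
by apply/dist_leP; exists [::].
Qed.

(* Every cycle of length at least four has a chord: an edge between two of its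
   vertices that are not consecutive on it. *)
Definition chordal (T : finType) (e : rel T) : Prop :=
  forall c : seq T, 3 < size c -> ucycle e c ->
    exists x y : T,
      [/\ x \in c, y \in c, e x y, y != next c x & x != next c y].

(* Indices start at 0 and [ordS] is the cyclic successor on ['I_n], so the last
   two clauses say that [y] is a cycle and that [x_i] is adjacent in [Y] to
   [y_i] and to the cyclic predecessor of [y_i] only.  As usual for suns, and
   so that [y] be a genuine cycle, [n] is at least 3. *)
Definition is_sun (T : finType) (e : rel T) : Prop :=
  chordal e /\
  exists n : nat, 2 < n /\
  exists x y : 'I_n -> T,
    [/\ injective x /\ injective y,
        (forall i j, x i != y j) /\
        (forall v, (exists i, v = x i) \/ (exists i, v = y i)),
        forall i j, ~~ e (x i) (x j),
        forall i, e (y i) (y (ordS i))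
      & forall i j, e (x i) (y j) = (i == j) || (i == ordS j)].

Definition induced (T : finType) (e : rel T) (S : {set T}) :
    rel {v : T | v \in S} :=
  fun u v => e (val u) (val v).

Definition sun_free_chordal (T : finType) (e : rel T) : Prop :=
  chordal e /\ ~ (exists S : {set T}, is_sun (@induced T e S)).

(* Main.v *)
Require Import Defs.
From mathcomp Require Import all_boot zify.

Set Implicit Arguments.
Unset Strict Implicit.
Unset Printing Implicit Defensive.

(* Always [rho_2k <= gamma_k <= rho_k], so the content is that
   [gamma_k = rho_k] forces [rho_k <= rho_2k].

   Let [H] be the [k]-th power of [G].  Then every nonempty set of vertices
   induces in [H] a subgraph with a simplicial vertex.  Write [k = 2 j + r] with
   [r] equal to 1 or 2: two vertices are adjacent in [H] iff the balls of radius
   [j] around them touch in [G^r], and [G^r] is chordal (for [r = 2] because the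
   vertices of a chordless cycle of [G^2] and midpoints of its edges induce a
   sun in [G]).  Touching graphs of connected sets inherit simplicial vertices.

   Hence the vertices of [H] are partitioned into cliques [Q_i], as many as the
   independence number.  If [gamma_k = rho_k], all maximal independent sets of
   [H] have the same size and thus meet every [Q_i].  Since [H] has no induced
   4-cycle, this is only possible if some [t_i] in [Q_i] has its closed
   neighbourhood in [Q_i], and the [t_i] form a [2k]-packing. *)

(** * Distance thresholds *)

Lemma dist_le_sym (T : finType) (e : rel T) k :
  symmetric e -> symmetric (dist_le e k).
Proof.
move=> e_sym; suff sub x y : dist_le e k x y -> dist_le e k y x.
  by move=> x y; apply/idP/idP; apply: sub.
case/dist_leP=> p [ep lp sp]; apply/dist_leP; exists (rev (belast x p)).
split; last by rewrite size_rev size_belast.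
  by rewrite -lp -(eq_path (e := fun a => e^~ a)) ?rev_path // => a b; apply: e_sym.
by case: p ep lp sp => //= a p _ _ _; rewrite rev_cons last_rcons.
Qed.

Lemma dist_le_refl (T : finType) (e : rel T) k : reflexive (dist_le e k).
Proof. by move=> x; apply/dist_leP; exists [::]. Qed.

Lemma dist_leW (T : finType) (e : rel T) k l x y :
  k <= l -> dist_le e k x y -> dist_le e l x y.
Proof.
move=> kl /dist_leP[p [ep lp sp]]; apply/dist_leP.
by exists p; split=> //; apply: leq_trans kl.
Qed.

Lemma dist_leD (T : finType) (e : rel T) k l x y :
  reflect (exists2 z, dist_le e k x z & dist_le e l z y)
          (dist_le e (k + l) x y).
Proof.
apply: (iffP idP) => [/dist_leP[p [ep lp sp]]|[z]]; last first.
  move=> /dist_leP[p [ep lp sp]] /dist_leP[q [eq lq sq]]; apply/dist_leP.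
  exists (p ++ q); rewrite cat_path last_cat lp ep eq size_cat.
  by split=> //; apply: leq_add.
move: ep lp; rewrite -(cat_take_drop k p) cat_path last_cat => /andP[ep1 ep2] lp.
exists (last x (take k p)); apply/dist_leP.
  by exists (take k p); split=> //; rewrite size_take_min geq_minl.
by exists (drop k p); split=> //; rewrite size_drop leq_subLR.
Qed.

Lemma dist_le1 (T : finType) (e : rel T) x y :
  dist_le e 1 x y = (x == y) || e x y.
Proof.
apply/dist_leP/idP => [[p [ep lp sp]]|/orP[/eqP->|exy]].
- case: p ep lp sp => [|a [|//]] /= ep lp _; first by rewrite lp eqxx.
  by move: ep; rewrite andbT lp => ->; rewrite orbT.
- by exists [::].
by exists [:: y]; rewrite /= exy.
Qed.

(** * Simplicial vertices of chordal graphs *)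

Definition restr (T : finType) (e : rel T) (D : {pred T}) : rel T :=
  fun a b => [&& a \in D, b \in D & e a b].

Lemma connect_restrS (T : finType) (e : rel T) (D E : {pred T}) x y :
  {subset D <= E} -> connect (restr e D) x y -> connect (restr e E) x y.
Proof.
move=> DE; apply: connect_sub => a b /and3P[aD bD eab].
by apply: connect1; rewrite /restr !DE.
Qed.

Lemma next_cat_cons (T : eqType) (s t : seq T) a b :
  uniq (s ++ a :: b :: t) -> next (s ++ a :: b :: t) a = b.
Proof.
move=> us; rewrite next_nth mem_cat inE eqxx orbT.
case: s us => [|c s] us /=; first by rewrite eqxx.
move: us; rewrite /= mem_cat inE !negb_or cat_uniq => /andP[/and3P[_ ca _]].
rewrite (negPf ca) => /and3P[_ /hasPn/(_ a)]; rewrite inE eqxx => /(_ isT) /= a_s _.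
by rewrite index_cat (negPf a_s) /= eqxx addn0 nth_cat ltnNge leqnSn /= subSnn.
Qed.

Lemma next_cons_last (T : eqType) (x : T) p :
  uniq (x :: p) -> next (x :: p) (last x p) = x.
Proof.
move=> up; rewrite next_nth mem_last index_last //.
by rewrite nth_default.
Qed.

(** Orders the two ends of a chord along the path, so that the segment [p3] between them can be
    bypassed. *)
Lemma path_split2 (T : eqType) (u : T) (p : seq T) a b :
  a \in u :: p -> b \in u :: p -> a != b ->
  exists w z p1 p3 p4, [/\ (w = a /\ z = b) \/ (w = b /\ z = a),
    last u p1 = w & p = p1 ++ p3 ++ z :: p4].
Proof.
move=> a_p; case/splitPl: a_p => p1 p2 la.
rewrite -cat_cons mem_cat => /orP[|] b_p ab; last first.
  by case/splitPr: b_p => p3 p4; exists a, b, p1, p3, p4; split=> //; left.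
case/splitPl: b_p la => q1 q2 lb; rewrite last_cat lb => la.
have : a \in q2.
  by have := mem_last b q2; rewrite la inE (negPf ab).
case/splitPr=> q3 q4; exists b, a, q1, q3, (q4 ++ p2).
by split; [right | | rewrite -!catA].
Qed.

(* A shortest path from [u] to [v] outside the neighbourhood of [x] closes up
   with [x] to a chordless cycle, so that it is a single edge. *)
Lemma chordal_fill (T : finType) (e : rel T) (D : {pred T}) (x u v : T) :
  symmetric e -> irreflexive e -> chordal e ->
  e x u -> e x v -> u != v ->
  (forall z, z \in D -> [|| z == u, z == v | (z != x) && ~~ e x z]) ->
  connect (restr e D) u v -> e u v.
Proof.
move=> e_sym e_irr e_ch xu xv uv HD /connectP[p ep lp].
elim: {p}(size p) {-2}p (leqnn (size p)) ep lp => [|n IH] p.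
  by case: p => // _ _ /= vu; rewrite vu eqxx in uv.
move=> sp ep lp; case: (shortenP ep) lp => q eq uq sq lq.
have {sp} {sq} sq : size q <= n.+1.
  apply: leq_trans sp; apply: uniq_leq_size sq.
  by case/andP: uq.
case: q eq uq sq lq => [|a q]; first by move=> _ _ _ /= vu; rewrite vu eqxx in uv.
case: q => [|b q] eq uq sq lq.
  by move: eq; rewrite /= lq /restr andbT => /and3P[].
have qD : {subset u :: a :: b :: q <= D}.
  move=> z; rewrite inE => /orP[/eqP->|].
    by move: eq => /= /andP[/and3P[]].
  elim: (a :: b :: q) (u) eq => //= d r IHr w /andP[/and3P[wD dD _] dr].
  by rewrite inE => /orP[/eqP->|] //; apply: IHr dr.
set p' := a :: b :: q in eq uq sq lq qD *.
have x_q : x \notin u :: p'.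
  apply/negP => /qD /HD; rewrite eqxx /= orbF.
  by case/orP=> /eqP xE; [move: xu | move: xv]; rewrite -xE e_irr.
have uc : uniq (x :: u :: p') by rewrite cons_uniq x_q.
have eqe : path e u p'.
  by apply: sub_path eq => c d /and3P[].
have cyc : ucycle e (x :: u :: p').
  have xp : path e x (u :: p') by apply/andP.
  by rewrite /ucycle uc andbT /cycle rcons_path xp -[last _ _]lq e_sym.
have [c [d [c_c d_c cd dnc cnd]]] := e_ch (x :: u :: p') isT cyc.
have nx : next (x :: u :: p') x = u by apply: (@next_cat_cons _ [::]).
have nv : next (x :: u :: p') v = x.
  by rewrite lq; apply: (@next_cons_last _ x (u :: p')).
have nox z : z \in u :: p' -> e x z -> z = u \/ z = v.
  by move/qD/HD => /or3P[/eqP->|/eqP->|/andP[_ /negP]] //; [left | right].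
(* No chord ends at [x]: its only neighbours on the path are [u] and [v], which are next to it on
   the cycle. *)
have neqx w z : w \in x :: u :: p' -> z \in x :: u :: p' -> e w z ->
    z != next (x :: u :: p') w -> w != next (x :: u :: p') z -> w != x.
  move=> w_c z_c wz znw wnz; apply: contraNneq znw => wx.
  move: wz z_c wnz; rewrite {}wx nx => xz.
  rewrite inE => /orP[/eqP zx|z_q]; first by rewrite zx e_irr in xz.
  by have [-> //|->] := nox z z_q xz; rewrite nv eqxx.
have c_x := neqx _ _ c_c d_c cd dnc cnd.
have d_x : d != x by apply: (neqx d c) => //; rewrite e_sym.
have {c_c c_x} c_q : c \in u :: p' by move: c_c; rewrite inE (negPf c_x).
have {d_c d_x} d_q : d \in u :: p' by move: d_c; rewrite inE (negPf d_x).
have c_d : c != d by apply: contraTneq cd => ->; rewrite e_irr.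
have [w [z [p1 [p3 [p4 [wz lw def_p]]]]]] := path_split2 c_q d_q c_d.
have {cd} ewz : e w z by case: wz => -[-> ->]; rewrite // e_sym.
have [w_q z_q] : w \in u :: p' /\ z \in u :: p' by case: wz => -[-> ->].
have {dnc cnd} znw : z != next (x :: u :: p') w by case: wz => -[-> ->].
(* With [p3] empty, [z] would follow [w] on the cycle; hence the chord makes the path strictly
   shorter. *)
have p3_gt0 : 0 < size p3.
  rewrite lt0n; apply: contraNneq znw => /size0nil p30.
  have cE : x :: u :: p' = (x :: belast u p1) ++ w :: z :: p4.
    by rewrite def_p p30 cat_cons -(cat_rcons w) -lw -lastI.
  by rewrite cE next_cat_cons // -cE.
apply: (IH (p1 ++ z :: p4)).
- rewrite -ltnS; apply: leq_trans sq; rewrite def_p !size_cat ltn_add2l.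
  by rewrite -[ltnLHS]add0n ltn_add2r.
- move: eq; rewrite def_p !cat_path /= lw => /and3P[-> _ /andP[_ ->]].
  by rewrite /restr ewz !qD.
by rewrite lq def_p !last_cat.
Qed.

Definition simplicial (T : finType) (R : rel T) (W : {set T}) (s : T) : Prop :=
  forall a b, a \in W -> b \in W -> R s a -> R s b -> R a b.

(** Quantifying over all induced subgraphs yields a perfect elimination ordering; for reflexive
    symmetric [R] this amounts to chordality. *)
Definition has_simplicial (T : finType) (R : rel T) : Prop :=
  forall W : {set T}, W != set0 -> exists2 s, s \in W & simplicial R W s.

(** A form of Dirac's theorem. Let [C] be the component of [y] among the non-neighbours of [x], and
    [B] its boundary. Then [B] lies in the neighbourhood of [x] and is a clique by [chordal_fill].
    The induction continues in [C :|: B], which omits [x]. *)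
Lemma simplicial_non_neighbour (T : finType) (e : rel T) (W : {set T}) (x y : T) :
  symmetric e -> irreflexive e -> chordal e ->
  x \in W -> y \in W -> x != y -> ~~ e x y ->
  exists s, [/\ s \in W, s != x, ~~ e x s &
    simplicial (fun a b => (a == b) || e a b) W s].
Proof.
move=> e_sym e_irr e_ch.
elim: {W}#|W| {-2}W (leqnn #|W|) x y => [|n IH] W sW x y xW yW xy nxy.
  by move: sW; rewrite leqn0 cards_eq0 => /eqP W0; rewrite W0 inE in xW.
pose D := [set z in W | (z != x) && ~~ e x z].
pose C := [set z in D | connect (restr e D) y z].
pose B := [set b in W | (b \notin C) && [exists c in C, e c b]].
have yC : y \in C by rewrite !inE yW eq_sym xy nxy connect0.
have CD z : z \in C -> [/\ z \in D, z \in W, z != x & ~~ e x z].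
  by rewrite !inE => /andP[/and3P[-> -> ->] _].
have CW z : z \in C -> z \in W by case/CD.
have BP b : b \in B -> e x b /\ exists2 c, c \in C & e c b.
  rewrite inE => /and3P[bW nbC /existsP[c /andP[cC ecb]]].
  split; last by exists c.
  apply: contraNT nbC => nxb; have [cD cW cx nxc] := CD c cC.
  have bD : b \in D.
    rewrite !inE bW nxb andbT; apply: contraNneq nxc => <-.
    by rewrite e_sym.
  rewrite inE bD; move: cC; rewrite inE => /andP[_ yc].
  by apply: connect_trans yc _; apply: connect1; rewrite /restr cD bD.
have BW b : b \in B -> b \in W by rewrite inE => /andP[].
have B_clique b b' : b \in B -> b' \in B -> b != b' -> e b b'.
  move=> /BP[xb [c cC ecb]] /BP[xb' [c' cC' ecb']] bb'.
  pose E := [set z | [|| z == b, z == b' | z \in D]].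
  have [bE bE'] : b \in E /\ b' \in E by rewrite !inE !eqxx ?orbT.
  have DE : {subset D <= E} by move=> z zD; rewrite inE zD !orbT.
  apply: (@chordal_fill T e (mem E) x) => //.
    move=> z; rewrite !inE => /or3P[->|->|/and3P[_ -> ->]] //.
    - by rewrite orbT.
    by rewrite !orbT.
  have [[cD _ _ _] [cD' _ _ _]] := (CD c cC, CD c' cC').
  have sC : connect_sym (restr e D).
    by apply: sym_connect_sym => u v; rewrite /restr e_sym andbCA.
  apply: connect_trans (_ : connect _ b c) _.
    by apply: connect1; rewrite /restr bE DE // e_sym.
  apply: connect_trans (_ : connect _ c c') _; last first.
    by apply: connect1; rewrite /restr bE' DE.
  apply: connect_restrS DE _; move: cC cC'; rewrite !inE => /andP[_ yc] /andP[_].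
  by apply: connect_trans; rewrite sC.
pose W' := C :|: B.
have xW' : x \notin W'.
  rewrite inE negb_or; apply/andP; split; apply/negP.
    by case/CD; rewrite eqxx.
  by case/BP; rewrite e_irr.
have W'W : W' \subset W by apply/subsetP => z; rewrite inE => /orP[/CW|/BW].
have lt : #|W'| <= n.
  rewrite -ltnS; apply: leq_trans sW; apply/proper_card/properP.
  by split=> //; exists x.
(* All neighbours in [W] of a vertex of [C] lie in [W'], so it remains to find a simplicial vertex
   of [W'] in [C]. *)
have lift s : s \in C -> simplicial (fun a b => (a == b) || e a b) W' s ->
    exists s, [/\ s \in W, s != x, ~~ e x s &
      simplicial (fun a b => (a == b) || e a b) W s].
  move=> sC simp; exists s; have [sD sW' sx nxs] := CD s sC; split=> //.
  have nb a : a \in W -> (s == a) || e s a -> a \in W'.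
    move=> aW /orP[/eqP<-|esa]; first by rewrite inE sC.
    rewrite inE; case aC : (a \in C) => //=.
    by rewrite inE aW aC /=; apply/existsP; exists s; rewrite sC.
  by move=> a b aW bW sa sb; apply: simp => //; apply: nb.
have [cl|] := boolP [forall a in W', forall b in W', (a == b) || e a b].
  apply: (lift y yC) => a b aW bW _ _.
  by move/forall_inP: cl => /(_ a aW)/forall_inP/(_ b bW).
(* If some [b] in [B] has a non-neighbour in [W'], the induction hypothesis at [b] gives a vertex
   not adjacent to [b], hence outside the clique [B]. Otherwise [B] is joined to all of [W'], and a
   vertex with a non-neighbour in [W'] cannot be in [B]. *)
have [fB|/forall_inPn[b bB /forall_inPn[z zW]]] :=
    boolP [forall a in B, forall b in W', (a == b) || e a b]; last first.
  rewrite negb_or => /andP[bz nbz] _.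
  have bW : b \in W' by rewrite inE bB orbT.
  have [s [sW' sb nbs simp]] := IH W' lt b z bW zW bz nbz.
  apply: (lift s) simp; move: sW'; rewrite inE => /orP[//|sB].
  by rewrite (B_clique b s) // eq_sym in nbs.
case/forall_inPn => a aW /forall_inPn[z zW]; rewrite negb_or => /andP[az naz].
have [s [sW' sa nas simp]] := IH W' lt a z aW zW az naz.
apply: (lift s) simp; move: sW'; rewrite inE => /orP[//|sB].
move/forall_inP: fB => /(_ s sB)/forall_inP/(_ a aW).
by rewrite (negPf sa) e_sym (negPf nas).
Qed.

Lemma chordal_has_simplicial (T : finType) (e : rel T) :
  symmetric e -> irreflexive e -> chordal e ->
  has_simplicial (fun a b => (a == b) || e a b).
Proof.
move=> e_sym e_irr e_ch W /set0Pn[x xW].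
have [cl|] := boolP [forall a in W, forall b in W, (a == b) || e a b].
  exists x => // a b aW bW _ _.
  by move/forall_inP: cl => /(_ a aW)/forall_inP/(_ b bW).
case/forall_inPn => a aW /forall_inPn[b bW]; rewrite negb_or => /andP[ab nab].
by have [s [sW _ _ simp]] := simplicial_non_neighbour e_sym e_irr e_ch aW bW ab nab; exists s.
Qed.

(** * Touching graphs of connected sets *)

Definition touch (T : finType) (R : rel T) (A B : {set T}) : bool :=
  [exists a in A, exists b in B, R a b].

Lemma touchP (T : finType) (R : rel T) (A B : {set T}) :
  reflect (exists a b, [/\ a \in A, b \in B & R a b]) (touch R A B).
Proof.
apply: (iffP existsP) => [[a /andP[aA /existsP[b /andP[bB ab]]]]|[a [b [aA bB ab]]]].
  by exists a, b.
by exists a; rewrite aA; apply/existsP; exists b; rewrite bB.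
Qed.

(** Connectivity through cuts instead of paths; the empty set and singletons qualify. *)
Definition connected_set (T : finType) (R : rel T) (A : {set T}) : Prop :=
  forall B : {set T}, B \subset A -> B != set0 -> B != A ->
    exists b a, [/\ b \in B, a \in A :\: B & R b a].

Lemma connected_setD1 (T : finType) (R : rel T) (S A : {set T}) s :
  symmetric R -> A \subset S -> simplicial R S s ->
  connected_set R A -> connected_set R (A :\ s).
Proof.
move=> R_sym AS simp cA; have [sA|sA] := boolP (s \in A); last first.
  suff -> : A :\ s = A by [].
  by apply/setDidPl; rewrite disjoint_sym disjoints1.
move=> B BA B0 BnA.
have sB : s \notin B by apply/negP => /(subsetP BA); rewrite !inE eqxx.
have BA' : B \subset A by apply: subset_trans BA (subsetDl _ _).
have B'A : B != A by apply: contraNneq sB => ->.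
have [b [a [bB]]] := cA B BA' B0 B'A.
rewrite inE => /andP[aB aA] Rba.
have [as_|a_s] := eqVneq a s; last by exists b, a; rewrite !inE aB aA a_s.
(* The crossing edge found ends in [s], so [s] is moved to the side of [B]. If the new crossing edge
   starts at [s], then [b] and [a'] are both neighbours of [s], hence adjacent. *)
have [|||b' [a' [b'B]]] := cA (s |: B).
- by rewrite subUset sub1set sA.
- by apply/set0Pn; exists s; rewrite !inE eqxx.
- by apply: contraNneq BnA => <-; rewrite setU1K.
rewrite !inE negb_or => /andP[/andP[a's a'B] a'A] Rb'a'.
move: b'B; rewrite !inE => /orP[/eqP b's|b'B]; last first.
  by exists b', a'; rewrite !inE a'B a'A a's.
exists b, a'; rewrite !inE a'B a'A a's; split=> //.
apply: simp; last by rewrite -b's.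
- by rewrite (subsetP AS) ?(subsetP BA').
- by rewrite (subsetP AS).
by rewrite R_sym -as_.
Qed.

(** A connected set that contains [s] and is not [[set s]] also contains another vertex adjacent to
    [s], by the cut at [[set s]]. This vertex can replace [s] in a touching pair, since neighbours
    of [s] are adjacent to each other. *)
Lemma touchD1 (T : finType) (R : rel T) (S A B : {set T}) s :
  reflexive R -> symmetric R -> simplicial R S s ->
  A \subset S -> B \subset S -> A != [set s] -> B != [set s] ->
  connected_set R A -> connected_set R B ->
  touch R (A :\ s) (B :\ s) = touch R A B.
Proof.
move=> R_refl R_sym simp AS BS As Bs cA cB.
have nb (X : {set T}) : X \subset S -> X != [set s] -> connected_set R X -> s \in X ->
    exists2 a, a \in X :\ s & R s a.
  move=> XS Xs cX sX; have [|||b [a [/set1P-> aX sa]]] := cX [set s].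
  - by rewrite sub1set.
  - by apply/set0Pn; exists s; rewrite inE.
  - by rewrite eq_sym.
  by exists a.
apply/touchP/touchP => -[a [b [aA bB ab]]].
  exists a, b; split=> //; [move: aA | move: bB]; rewrite inE => /andP[] //.
have inS (X : {set T}) z : X \subset S -> z \in X :\ s -> z \in S.
  by move=> /subsetP XS; rewrite inE => /andP[_ /XS].
have [as_|a_s] := eqVneq a s; have [bs|b_s] := eqVneq b s.
- have [a' a'A sa'] : exists2 a, a \in A :\ s & R s a.
    by apply: nb => //; rewrite -as_.
  have [b' b'B sb'] : exists2 b, b \in B :\ s & R s b.
    by apply: nb => //; rewrite -bs.
  by exists a', b'; split=> //; apply: simp => //; [apply: inS a'A | apply: inS b'B].
- have [a' a'A sa'] : exists2 a, a \in A :\ s & R s a.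
    by apply: nb => //; rewrite -as_.
  exists a', b; rewrite !inE b_s bB; split; rewrite -?in_setD1 //.
  by apply: simp => //; [apply: inS a'A | apply: (subsetP BS) | rewrite -as_].
- have [b' b'B sb'] : exists2 b, b \in B :\ s & R s b.
    by apply: nb => //; rewrite -bs.
  exists a, b'; rewrite !inE a_s aA; split; rewrite -?in_setD1 //.
  by apply: simp => //; [apply: (subsetP AS) | apply: inS b'B | rewrite R_sym -bs].
by exists a, b; rewrite !inE a_s b_s aA bB.
Qed.

(* Deleting a simplicial vertex [s] from all the sets changes neither their
   connectedness nor which of them touch, until some set is [[set s]]. *)
Lemma touch_has_simplicial (T I : finType) (R : rel T) (A : I -> {set T}) :
  reflexive R -> symmetric R -> has_simplicial R ->
  (forall i, A i != set0) -> (forall i, connected_set R (A i)) ->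
  has_simplicial (fun i j => touch R (A i) (A j)).
Proof.
move=> R_refl R_sym simpR A0 Ac W W0.
have {A0 Ac} : forall i, i \in W ->
    [/\ A i != set0, connected_set R (A i) & A i \subset [set: T]].
  by move=> i _; rewrite A0 subsetT.
elim: #|[set: T]| {-2}[set: T] A (leqnn #|[set: T]|) => [|n IH] S A sS HS.
  have /set0Pn[i iW] := W0; have [A0 _] := HS i iW.
  by move: sS; rewrite leqn0 cards_eq0 => /eqP->; rewrite subset0 (negPf A0).
have S0 : S != set0.
  have /set0Pn[i iW] := W0; have [A0 _ AS] := HS i iW.
  by apply: contraNneq A0 => S0; rewrite -subset0 -S0.
have [s sS' simp] := simpR S S0.
(* Sets that touch [[set s]] contain neighbours of [s], so they touch each other and [w] is
   simplicial. *)
have [/exists_inP[w wW /eqP ws]|] := boolP [exists w in W, A w == [set s]].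
  exists w => // i j iW jW /touchP[s1 [a [+ aA sa]]] /touchP[s2 [b [+ bA sb]]].
  rewrite ws !inE => /eqP s1s /eqP s2s; subst s1 s2.
  have [_ _ AS] := HS i iW; have [_ _ BS] := HS j jW.
  apply/touchP; exists a, b; split=> //.
  by apply: simp => //; [apply: (subsetP AS) | apply: (subsetP BS)].
move/exists_inPn => nos.
have lt : #|S :\ s| <= n by rewrite -ltnS; apply: leq_trans sS; rewrite [ltnRHS](cardsD1 s) sS'.
have [i iW|w wW simpw] := IH _ (fun i => A i :\ s) lt.
  have [A0 Ac AS] := HS i iW; split.
  - apply: contraNneq (nos i iW) => /eqP; rewrite setD_eq0 subset1.
    by rewrite (negPf A0) orbF.
  - exact: connected_setD1 AS simp Ac.
  - exact: setSD.
have touchE i j : i \in W -> j \in W ->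
    touch R (A i :\ s) (A j :\ s) = touch R (A i) (A j).
  move=> iW jW; have [_ Ac AS] := HS i iW; have [_ Bc BS] := HS j jW.
  by apply: (@touchD1 _ _ S) => //; apply: nos.
exists w => // i j iW jW; rewrite -!touchE //; exact: simpw.
Qed.

(** * Independent sets and clique covers *)

Definition indep (T : finType) (R : rel T) (I : {set T}) : Prop :=
  forall x y, x \in I -> y \in I -> R x y -> x = y.

(** Greedy choice: a simplicial [s] enters [I], its closed neighbourhood becomes a clique of the
    cover, and the non-neighbours of [s] are treated recursively. The map [f] sends a vertex to the
    representative of its clique. *)
Lemma indep_clique_cover (T : finType) (R : rel T) (W : {set T}) :
  reflexive R -> symmetric R -> has_simplicial R ->
  exists (I : {set T}) (f : T -> T),
    [/\ I \subset W, indep R I, forall x, x \in W -> f x \in I &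
        forall x y, x \in W -> y \in W -> f x = f y -> R x y].
Proof.
move=> R_refl R_sym simpR.
elim: {W}#|W| {-2}W (leqnn #|W|) => [|n IH] W sW.
  exists set0, id; move: sW; rewrite leqn0 cards_eq0 => /eqP->.
  by split=> [|x y|x|x y]; rewrite ?sub0set // inE.
have [->|W0] := eqVneq W set0.
  by exists set0, id; split=> [|x y|x|x y]; rewrite ?sub0set // inE.
have [s sW' simp] := simpR W W0.
pose W' := [set x in W | ~~ R s x].
have [|I [f [IW indI fI fcl]]] := IH W'.
  rewrite -ltnS; apply: leq_trans sW; apply/proper_card/properP; split.
    by apply/subsetP => x; rewrite inE => /andP[].
  by exists s => //; rewrite inE R_refl andbF.
have IP x : x \in I -> x \in W /\ ~~ R s x.
  by move/(subsetP IW); rewrite inE => /andP[].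
exists (s |: I), (fun x => if R s x then s else f x); split.
- apply/subsetP => x; rewrite !inE => /orP[/eqP->|/IP[]] //.
- move=> x y; rewrite !inE => /orP[/eqP->|xI] /orP[/eqP->|yI] //.
  + by have [_ /negPf->] := IP y yI.
  + by rewrite R_sym; have [_ /negPf->] := IP x xI.
  exact: indI.
- move=> x xW; case: ifP => sx; first by rewrite setU11.
  by rewrite inE fI ?orbT // inE xW sx.
move=> x y xW yW; case: ifP => sx; case: ifP => sy; first by move=> _; apply: simp.
- move=> sf; have yW' : y \in W' by rewrite inE yW sy.
  by have [_] := IP _ (fI y yW'); rewrite -sf R_refl.
- move=> sf; have xW' : x \in W' by rewrite inE xW sx.
  by have [_] := IP _ (fI x xW'); rewrite sf R_refl.
by apply: fcl; rewrite inE ?xW ?yW ?sx ?sy.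
Qed.

(** A vertex without neighbours in an inclusion-maximal independent set could be added to it. *)
Lemma max_indep (T : finType) (R : rel T) (I : {set T}) :
  reflexive R -> symmetric R -> indep R I ->
  exists J : {set T}, [/\ I \subset J, indep R J &
    forall x, exists2 y, y \in J & R x y].
Proof.
move=> R_refl R_sym indI.
pose P := [pred J : {set T} | (I \subset J) &&
  [forall x in J, forall y in J, R x y ==> (x == y)]].
have indP J : reflect (indep R J) [forall x in J, forall y in J, R x y ==> (x == y)].
  apply: (iffP forall_inP) => [H x y xJ yJ xy|H x xJ].
    by have /forall_inP/(_ y yJ) := H x xJ; rewrite xy => /eqP.
  by apply/forall_inP => y yJ; apply/implyP => xy; apply/eqP/H.
have PI : P I by rewrite /= subxx; apply/indP.
have [J /maxsetP[/andP[IJ /indP indJ] maxJ] _] := maxset_exists PI.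
exists J; split=> // x.
have [/exists_inP[y yJ xy]|/exists_inPn nx] := boolP [exists y in J, R x y].
  by exists y.
exists x => //; rewrite -[J](maxJ (x |: J)) ?setU11 ?subsetU1 //.
apply/andP; split; first by apply: subset_trans IJ (subsetU1 _ _).
apply/indP => a b; rewrite !inE => /orP[/eqP->|aJ] /orP[/eqP->|bJ] //.
- by rewrite (negPf (nx b bJ)).
- by rewrite R_sym (negPf (nx a aJ)).
exact: indJ.
Qed.

(* A smallest set of vertices outside the clique [Q] that dominates [Q] is
   independent: otherwise two adjacent members and private neighbours of them
   in [Q] would induce a 4-cycle, which has no simplicial vertex. *)
Lemma clique_indep_dominated (T : finType) (R : rel T) (Q : {set T}) :
  reflexive R -> symmetric R -> has_simplicial R ->
  (forall x y, x \in Q -> y \in Q -> R x y) ->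
  (forall x, x \in Q -> exists2 y, y \notin Q & R x y) ->
  exists I : {set T}, [/\ indep R I, [disjoint I & Q] &
    forall x, x \in Q -> exists2 y, y \in I & R x y].
Proof.
move=> R_refl R_sym simpR Qcl Qout.
pose P := [pred I : {set T} | [disjoint I & Q] &&
  [forall x in Q, [exists y in I, R x y]]].
have PC : P (~: Q).
  rewrite /= -setI_eq0 setIC setICr eqxx; apply/forall_inP => x /Qout[y yQ xy].
  by apply/exists_inP; exists y; rewrite ?inE.
have [I /minsetP[/andP[IQ /forall_inP domI] minI] _] := minset_exists PC.
exists I; split=> // [u w uI wI uw|x xQ]; last exact/exists_inP/domI.
apply/eqP/negPn/negP => u_w.
have priv z : z \in I -> exists q, [/\ q \in Q, R q z &
    forall y, y \in I -> y != z -> ~~ R q y].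
  move=> zI; have : ~~ P (I :\ z).
    apply/negP => PI; have := minI _ PI (subsetDl _ _) => /setP/(_ z).
    by rewrite !inE eqxx zI.
  rewrite negb_and (disjointWl (subsetDl _ _) IQ) /=.
  case/forall_inPn => q qQ /exists_inPn nq; exists q.
  have np y : y \in I -> y != z -> ~~ R q y by move=> yI yz; apply: nq; rewrite !inE yz.
  split=> //; have /exists_inP[y yI qy] := domI q qQ.
  by have [<- //|yz] := eqVneq y z; rewrite (negPf (np y yI yz)) in qy.
have [a [aQ au anw]] := priv u uI; have [b [bQ bw bnu]] := priv w wI.
have {}anw : ~~ R a w by apply: anw; rewrite // eq_sym.
have {}bnu : ~~ R b u by apply: bnu.
have ab := Qcl a b aQ bQ.
have [|s sW simp] := simpR [set u; w; a; b].
  by apply/set0Pn; exists u; rewrite !inE eqxx.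
have uW : u \in [set u; w; a; b] by rewrite !inE eqxx.
have wW : w \in [set u; w; a; b] by rewrite !inE eqxx ?orbT.
have aW : a \in [set u; w; a; b] by rewrite !inE eqxx ?orbT.
have bW : b \in [set u; w; a; b] by rewrite !inE eqxx ?orbT.
(* On the 4-cycle [u], [w], [b], [a] every vertex has two non-adjacent neighbours. *)
move: sW; rewrite !inE -!orbA => /or4P[] /eqP sE; rewrite {}sE in simp.
- by have := simp a w aW wW; rewrite R_sym au uw (negPf anw) => /(_ isT isT).
- by have := simp b u bW uW; rewrite R_sym bw R_sym uw (negPf bnu) => /(_ isT isT).
- by have := simp b u bW uW; rewrite ab au (negPf bnu) => /(_ isT isT).
by have := simp a w aW wW; rewrite R_sym ab bw (negPf anw) => /(_ isT isT).
Qed.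

(* If no independent set is larger than any maximal one, each clique of a
   minimum clique cover contains a closed neighbourhood, and these are disjoint. *)
Lemma disjoint_nbhds (T : finType) (R : rel T) (n : nat) :
  reflexive R -> symmetric R -> has_simplicial R ->
  (forall I : {set T}, indep R I -> #|I| <= n) ->
  (forall J : {set T}, (forall x, exists2 y, y \in J & R x y) -> n <= #|J|) ->
  exists P : {set T}, n <= #|P| /\
    forall x y z, x \in P -> y \in P -> R x z -> R y z -> x = y.
Proof.
move=> R_refl R_sym simpR indn domn.
have [I [f [_ indI fI fcl]]] := indep_clique_cover [set: T] R_refl R_sym simpR.
have {}fI x : f x \in I by apply: fI.
have {}fcl x y : f x = f y -> R x y by apply: fcl.
have t_ex i : i \in I -> exists t, [forall z, R t z ==> (f z == i)].
  move=> iI.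
  have [/existsP //|/existsPn not] := boolP [exists t, [forall z, R t z ==> (f z == i)]].
  pose Q := [set z | f z == i].
  have [| |I' [indI' IQ domI']] := @clique_indep_dominated T R Q R_refl R_sym simpR.
  - by move=> x y; rewrite !inE => /eqP fx /eqP fy; apply: fcl; rewrite fx.
  - move=> x _; have /forallPn[y] := not x; rewrite negb_imply => /andP[xy fy].
    by exists y; rewrite ?inE.
  have [J [I'J indJ domJ]] := max_indep R_refl R_sym indI'.
  have fJ : {in J &, injective f} by move=> x y xJ yJ /fcl; apply: indJ.
  (* The set [J] misses [Q]: a member in [Q] would be adjacent to a member of [I'], which is outside
     [Q]. So [f] maps [J] injectively into [I] without [i], and the dominating set [J] is too
     small. *)
  have : #|J| < n.
    rewrite -(card_in_imset fJ); apply: leq_trans (indn _ indI).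
    apply/proper_card/properP; split.
      by apply/subsetP => _ /imsetP[x _ ->].
    exists i => //; apply/imsetP => -[x xJ fx].
    have xQ : x \in Q by rewrite inE fx.
    have [y yI' xy] := domI' x xQ.
    have yx : x = y by apply: indJ xy => //; apply: (subsetP I'J).
    by move/pred0P: IQ => /(_ x); rewrite /= xQ yx yI'.
  by rewrite ltnNge domn.
(* By [t_ex] the default is never taken for [i] in [I]. *)
pose t i := odflt i [pick t | [forall z, R t z ==> (f z == i)]].
have tP i z : i \in I -> R (t i) z -> f z = i.
  move=> iI; rewrite /t; case: pickP => [u /forallP/(_ z)/implyP fz /fz/eqP //|no].
  by have [u] := t_ex i iI; rewrite no.
have ft i : i \in I -> f (t i) = i by move=> iI; apply: tP.
exists (t @: I); split.
  rewrite card_in_imset => [|i j iI jI tij]; last by rewrite -[i]ft // tij ft.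
  have [J [_ indJ domJ]] : exists J : {set T}, [/\ set0 \subset J, indep R J &
      forall x, exists2 y, y \in J & R x y].
    by apply: max_indep => // x y; rewrite inE.
  apply: leq_trans (domn _ domJ) _.
  have fJ : {in J &, injective f} by move=> x y xJ yJ /fcl; apply: indJ.
  rewrite -(card_in_imset fJ); apply: subset_leq_card.
  by apply/subsetP => _ /imsetP[x _ ->].
move=> _ _ z /imsetP[i iI ->] /imsetP[j jI ->] tiz tjz.
by rewrite -(tP i z) // (tP j z).
Qed.

(** * Domination and packing numbers *)

Lemma gamma_le (T : finType) (e : rel T) k (D : {set T}) :
  dominating e k D -> gamma e k <= #|D|.
Proof.
by move=> domD; rewrite /gamma; case: arg_minnP => [|E _]; [apply: dominating_setT | apply].
Qed.

Lemma gamma_witness (T : finType) (e : rel T) k :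
  exists2 D : {set T}, dominating e k D & gamma e k = #|D|.
Proof.
rewrite /gamma; case: arg_minnP => [|D domD _]; first exact: dominating_setT.
by exists D.
Qed.

Lemma rho_ge (T : finType) (e : rel T) k (S : {set T}) :
  packing e k S -> #|S| <= rho e k.
Proof. by move=> pS; rewrite /rho (@leq_bigmax_cond _ (packing e k) (fun S => #|S|)). Qed.

Lemma rho_witness (T : finType) (e : rel T) k :
  exists2 S : {set T}, packing e k S & rho e k = #|S|.
Proof.
have p0 : packing e k set0 by apply/forall_inP => x; rewrite inE.
have P0 : 0 < #|packing e k| by apply/card_gt0P; exists set0.
by have [S pS rS] := eq_bigmax_cond (fun S : {set T} => #|S|) P0; exists S.
Qed.

Lemma packingP (T : finType) (e : rel T) k (S : {set T}) :
  reflect (indep (dist_le e k) S) (packing e k S).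
Proof.
apply: (iffP forall_inP) => [H x y xS yS xy|H x xS].
  have /forall_inP/(_ y yS) := H x xS; rewrite xy implybF.
  by move/negPn/eqP.
apply/forall_inP => y yS; apply/implyP; apply: contra => xy.
exact/eqP/H.
Qed.

Lemma dominatingP (T : finType) (e : rel T) k (D : {set T}) :
  reflect (forall x, exists2 y, y \in D & dist_le e k x y) (dominating e k D).
Proof.
by apply: (iffP forallP) => H x; apply/exists_inP.
Qed.

(** A maximal packing is dominating. *)
Lemma gamma_le_rho (T : finType) (e : rel T) k :
  symmetric e -> gamma e k <= rho e k.
Proof.
move=> e_sym.
have [J [_ indJ domJ]] : exists J : {set T}, [/\ set0 \subset J,
    indep (dist_le e k) J & forall x, exists2 y, y \in J & dist_le e k x y].
  apply: max_indep; first exact: dist_le_refl; first exact: dist_le_sym.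
  by move=> x y; rewrite inE.
apply: leq_trans (gamma_le _) (rho_ge _); first exact/dominatingP/domJ.
exact/packingP.
Qed.

(** Distinct members of a [2 * k]-packing cannot be dominated by the same vertex. *)
Lemma rho_double_le_gamma (T : finType) (e : rel T) k :
  symmetric e -> rho e (2 * k) <= gamma e k.
Proof.
move=> e_sym; have [S /packingP indS ->] := rho_witness e (2 * k).
have [D /dominatingP domD ->] := gamma_witness e k.
have /fin_all_exists2[f fD fd] := domD.
rewrite -(card_in_imset (f := f)).
  by apply/subset_leq_card/subsetP => _ /imsetP[x _ ->].
move=> x y xS yS fxy; apply: indS => //; rewrite mul2n -addnn.
by apply/dist_leD; exists (f x) => //; rewrite fxy dist_le_sym.
Qed.

(** Vertices with pairwise disjoint balls of radius [k] form a [2 * k]-packing. *)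
Lemma rho_double_ge (T : finType) (e : rel T) k :
  symmetric e -> has_simplicial (dist_le e k) -> gamma e k = rho e k ->
  rho e k <= rho e (2 * k).
Proof.
move=> e_sym simp gr.
have [| |P [Pn Pd]] := disjoint_nbhds (n := rho e k) (@dist_le_refl _ e k)
    (dist_le_sym k e_sym) simp.
- by move=> I indI; apply/rho_ge/packingP.
- by move=> J domJ; rewrite -gr; apply/gamma_le/dominatingP.
apply: leq_trans Pn (rho_ge _); apply/packingP => x y xP yP.
rewrite mul2n -addnn => /dist_leD[z xz zy]; apply: (Pd x y z) => //.
by rewrite dist_le_sym.
Qed.

(** * Squares of sun-free chordal graphs *)

Lemma chordal_induced (T : finType) (e : rel T) (S : {set T}) :
  chordal e -> chordal (@induced T e S).
Proof.
move=> e_ch c c3 /andP[cyc uc].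
have [||u [v [+ + uv nu nv]]] := e_ch (map val c); first by rewrite size_map.
  by rewrite /ucycle map_inj_uniq ?uc ?andbT ?cycle_map //; apply: val_inj.
move=> /mapP[u' u'c uE] /mapP[v' v'c vE]; exists u', v'; split=> //.
- by rewrite /induced -uE -vE.
- by apply: contraNneq nu; rewrite uE vE next_map //; [move-> | apply: val_inj].
by apply: contraNneq nv; rewrite uE vE next_map //; [move-> | apply: val_inj].
Qed.

Lemma eq_ordS n (i j : 'I_n) :
  (i == ordS j) = (i == j.+1 :> nat) || (i == 0 :> nat) && (j.+1 == n).
Proof.
rewrite -val_eqE /=; have jn := ltn_ord j; have := ltn_ord i.
have [->|jn'] := eqVneq j.+1 n; first by rewrite modnn; lia.
by rewrite modn_small; lia.
Qed.

(* Let [y i] be within distance 1 of [x i] and [x i.+1].  In the subgraph of the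
   [x i] and [y i] the vertex [x i] has only one neighbour on either side of it
   on the cycle, so that by chordality these two are adjacent ([tri]).  This
   excludes edges between consecutive [x i], and otherwise makes the [y i] a
   cycle. *)
Lemma square_cycle_sun (T : finType) (e : rel T) (n : nat) (x : nat -> T) :
  symmetric e -> irreflexive e -> chordal e -> 3 < n ->
  (forall i, x (i + n) = x i) ->
  (forall i m, 0 < m < n -> x i != x (i + m)) ->
  (forall i, dist_le e 2 (x i) (x i.+1)) ->
  (forall i m, 0 < m < n -> dist_le e 2 (x i) (x (i + m)) ->
     m = 1 \/ m = n.-1) ->
  exists S : {set T}, is_sun (@induced T e S).
Proof.
move=> e_sym e_irr e_ch n3 xn x_inj near far.
pose adj := dist_le e 1.
have adj_sym a b : adj a b = adj b a by apply: dist_le_sym.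
have adjD a b c : adj a b -> adj b c -> dist_le e 2 a c.
  by move=> ab bc; apply/(@dist_leD _ e 1 1); exists b.
have eadj a b : e a b -> adj a b by rewrite /adj dist_le1 orbC => ->.
have adjNe a b : a != b -> adj a b -> e a b.
  by move=> ab; rewrite /adj dist_le1 (negPf ab).
pose y i := odflt (x i) [pick z | adj (x i) z && adj z (x i.+1)].
have [xy yx] : (forall i, adj (x i) (y i)) /\ (forall i, adj (y i) (x i.+1)).
  suff xyx i : adj (x i) (y i) && adj (y i) (x i.+1).
    by split=> i; case/andP: (xyx i).
  rewrite /y; case: pickP => [//|no].
  by have /(@dist_leD _ e 1 1)[z xz zx] := near i; have := no z; rewrite /adj xz zx.
have yn i : y (i + n) = y i by rewrite /y -addSn !xn.
(* Otherwise [x i] would be within distance 2 of both [x (i + m)] and its successor, which for these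
   [m] forces [n] to be 3. *)
have far_y i m : 0 < m < n.-1 -> ~~ adj (x i) (y (i + m)).
  move=> mn; apply/negP => xiy.
  have := far i m; have := far i m.+1; rewrite addnS.
  have -> : dist_le e 2 (x i) (x (i + m)) by apply: adjD xiy _; rewrite adj_sym.
  have -> : dist_le e 2 (x i) (x (i + m).+1) by apply: adjD xiy _.
  lia.
have near_far i : ~~ dist_le e 2 (x i.+1) (x (i + n.-1)).
  apply/negP => H; have := far i.+1 n.-2.
  have -> : i.+1 + n.-2 = i + n.-1 by lia.
  by rewrite H; lia.
have tri i u v : e (x i) u -> e (x i) v -> adj u (x i.+1) ->
    adj (x (i + n.-1)) v -> (e (x i) (x i.+1) -> u = x i.+1) ->
    (e (x i) (x (i + n.-1)) -> v = x (i + n.-1)) -> e u v.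
  move=> xu xv ux vx uE vE.
  (* Inside [D] one goes from [u] to [v] the long way round the cycle, alternating between the [x]
     and the [y]. The last two hypotheses of [tri] keep the end points [x i.+1] and [x (i + n.-1)]
     in [D]. *)
  pose D := [set z | [|| z == u, z == v | ~~ adj (x i) z]].
  have step a b : a \in D -> b \in D -> adj a b -> connect (restr e D) a b.
    move=> aD bD; have [->|ab /adjNe eab] := eqVneq a b; first by rewrite connect0.
    by apply: connect1; rewrite /restr aD bD eab.
  have xD m : 0 < m < n -> x (i + m) \in D.
    move=> mn; rewrite inE; case H : (adj _ _); rewrite ?orbT //=.
    have xixm := adjNe _ _ (x_inj i m mn) H.
    have := far i m mn; rewrite (dist_leW (leqnSn 1) H) => -[//|m1|m1].
      by move: xixm; rewrite m1 addn1 => /uE->; rewrite eqxx.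
    by move: xixm; rewrite m1 => /vE->; rewrite eqxx orbT.
  have yD m : 0 < m < n.-1 -> y (i + m) \in D.
    by move=> mn; rewrite inE far_y // !orbT.
  apply: (@chordal_fill T e (mem D) (x i)) => //.
  - apply: contraNneq (near_far i) => uv.
    by apply: (adjD _ u); rewrite adj_sym // uv.
  - move=> z; rewrite !inE => /or3P[->|->|]; rewrite ?orbT //.
    by rewrite /adj dist_le1 eq_sym negb_or => ->; rewrite !orbT.
  have chain m : m < n.-1 -> connect (restr e D) (x i.+1) (x (i + m.+1)).
    elim: m => [|m IH] mn; first by rewrite addn1 connect0.
    apply: connect_trans (IH _) _; first by lia.
    apply: connect_trans (step _ (y (i + m.+1)) _ _ _) (step _ _ _ _ _) => //.
    - by apply: xD; lia.
    - by apply: yD; lia.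
    - by apply: yD; lia.
    - by apply: xD; lia.
    by rewrite (addnS i m.+1).
  have uD : u \in D by rewrite inE eqxx.
  have vD : v \in D by rewrite inE eqxx orbT.
  apply: connect_trans (step u (x i.+1) _ _ _) _ => //.
    by rewrite -addn1; apply: xD; lia.
  have nE : n.-2.+1 = n.-1 by lia.
  have := chain n.-2; rewrite nE leqnn => ch.
  apply: connect_trans (ch isT) (step _ _ _ _ _) => //.
  by apply: xD; lia.
have xpred i : x (i + n.-1).+1 = x i by rewrite -addnS prednK ?xn //; lia.
have x_pred i : x (i + n.-1) != x i by rewrite eq_sym; apply: x_inj; lia.
have x_succ i : x i != x i.+1 by rewrite -addn1; apply: x_inj; lia.
have nadj i : ~~ e (x i) (x i.+1).
  apply/negP => xx.
  (* With [u] equal to [x i.+1], [tri] makes [x i.+1] adjacent to [v], which is too close to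
     [x (i + n.-1)] by [near_far]. *)
  pose v := if e (x i) (x (i + n.-1)) then x (i + n.-1) else y (i + n.-1).
  have xv : e (x i) v.
    rewrite /v; case: ifP => // /negP nx; apply/adjNe.
      apply: contra_not_neq nx => xy'; rewrite e_sym; apply/adjNe => //.
      by rewrite xy'.
    by rewrite adj_sym -[x i]xpred.
  have vx : adj (x (i + n.-1)) v.
    by rewrite /v; case: ifP => // _; rewrite /adj dist_le_refl.
  have := near_far i; rewrite (adjD _ v) //; last by rewrite adj_sym.
  apply/eadj/(tri i) => //; first by rewrite /adj dist_le_refl.
  by rewrite /v => ->.
have x_y i : x i != y i.
  by apply: contraNneq (nadj i) => xy'; apply/adjNe; rewrite // xy'.
have y_x i : y i != x i.+1.
  by apply: contraNneq (nadj i) => yx'; apply/adjNe => //; rewrite -yx'.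
have exy i : e (x i) (y i) by apply/adjNe.
have eyx i : e (y i) (x i.+1) by apply/adjNe.
have ex'y i : e (x i.+1) (y i) by rewrite e_sym.
have eyy i : e (y i) (y i.+1).
  rewrite e_sym; have -> : y i = y (i.+1 + n.-1).
    by rewrite -[y i]yn; congr y; lia.
  have iE : i.+1 + n.-1 = i + n by lia.
  apply: (tri i.+1) => //; rewrite ?iE ?yn ?xn //.
    by rewrite (negPf (nadj _)).
  by rewrite e_sym (negPf (nadj _)).
have x_ordS (i : 'I_n) : x (ordS i) = x i.+1.
  rewrite /=; have := ltn_ord i; rewrite leq_eqVlt => /orP[/eqP->|lt].
    by rewrite modnn -[x 0]xn add0n.
  by rewrite modn_small.
have y_ordS (i : 'I_n) : y (ordS i) = y i.+1.
  rewrite /=; have := ltn_ord i; rewrite leq_eqVlt => /orP[/eqP->|lt].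
    by rewrite modnn -[y 0]yn add0n.
  by rewrite modn_small.
have exyE (i j : 'I_n) : e (x i) (y j) = (i == j) || (i == ordS j).
  apply/idP/orP => [exiyj|[/eqP->//|/eqP->]]; last by rewrite x_ordS.
  have [ni nj] := (ltn_ord i, ltn_ord j).
  (* The number of steps from [i] to [j] around the cycle; [far_y] leaves only 0 and [n.-1]. *)
  pose m := if i <= j then j - i else j + n - i.
  have yE : y (i + m) = y j.
    rewrite /m; case: (leqP i j) => ij; first by rewrite subnKC.
    by rewrite subnKC ?yn //; lia.
  have : ~~ (0 < m < n.-1).
    by apply: contraL (eadj _ _ exiyj) => mn; rewrite -yE; apply: far_y.
  rewrite eq_ordS -val_eqE /m /=; case: (leqP i j); lia.
have x_injn (i j : 'I_n) : x i = x j -> i = j.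
  move=> xij; apply/val_inj/eqP/negPn/negP => /=; rewrite neq_ltn => /orP[] lt.
    have := x_inj i (j - i); rewrite subnKC ?xij ?eqxx; last by lia.
    by have := ltn_ord j; lia.
  have := x_inj j (i - j); rewrite subnKC ?xij ?eqxx; last by lia.
  by have := ltn_ord i; lia.
(* Equal [y i] and [y j] have the same two neighbours among the [x], which determine the index since
   [n] exceeds 2. *)
have y_injn (i j : 'I_n) : y i = y j -> i = j.
  move=> yij; have := exyE i j; have := exyE (ordS i) j.
  rewrite -yij x_ordS ex'y exy !eq_ordS -!val_eqE /= => /esym + /esym.
  have [ni nj] := (ltn_ord i, ltn_ord j).
  have [i1|ni'] := eqVneq i.+1 n.
    by rewrite i1 modnn => H1 H2; apply: val_inj => /=; lia.
  have i1 : i.+1 < n by rewrite ltn_neqAle ni'.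
  by rewrite (modn_small i1) => H1 H2; apply: val_inj => /=; lia.
have xx_lt (i j : 'I_n) : i < j -> ~~ e (x i) (x j).
  move=> ij; have jn := ltn_ord j; apply/negP => xij.
  have mn : 0 < j - i < n by lia.
  have := far i (j - i) mn; rewrite subnKC ?(ltnW ij) //.
  move/(_ (dist_leW (leqnSn 1) (eadj _ _ xij))) => [] ji.
    have jE : i.+1 = j by lia.
    by have := nadj i; rewrite jE xij.
  have jE : j.+1 = i + n by lia.
  by have := nadj j; rewrite jE xn e_sym xij.
have xx (i j : 'I_n) : ~~ e (x i) (x j).
  have [/xx_lt //|/xx_lt|/val_inj->] := ltngtP i j; first by rewrite e_sym.
  by rewrite e_irr.
have xy_neq (i j : 'I_n) : x i != y j.
  by apply: contraNneq (xx j i) => ->.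
pose S := [set z | [exists i : 'I_n, (z == x i) || (z == y i)]].
have xS (i : 'I_n) : x i \in S by rewrite inE; apply/existsP; exists i; rewrite eqxx.
have yS (i : 'I_n) : y i \in S by rewrite inE; apply/existsP; exists i; rewrite eqxx orbT.
exists S; split; first exact: chordal_induced.
exists n; split; first exact: ltnW.
exists (fun i : 'I_n => exist _ (x i) (xS i)), (fun i : 'I_n => exist _ (y i) (yS i)).
split.
- by split=> i j [] => [/x_injn|/y_injn].
- split=> [i j|[z zS]]; first exact: xy_neq.
  have := zS; rewrite inE => /existsP[i /orP[] /eqP zE]; [left | right]; exists i;
    exact: val_inj.
- exact: xx.
- by move=> i; rewrite /induced /= -/(ordS i) y_ordS.
exact: exyE.
Qed.

Lemma chordal_square (T : finType) (e : rel T) :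
  symmetric e -> irreflexive e -> sun_free_chordal e ->
  chordal (fun a b => (a != b) && dist_le e 2 a b).
Proof.
move=> e_sym e_irr [e_ch no_sun] c c3 /andP[cyc uc].
set F := fun a b => _ in cyc *.
have [/exists_inP[u uc' /exists_inP[v vc' /and3P[]]]|nc] :=
  boolP [exists u in c, [exists v in c, [&& F u v, v != next c u & u != next c v]]].
  by exists u, v.
case: no_sun.
case: c c3 cyc uc nc => // z0 p c3 cyc uc nc; set c := z0 :: p in c3 cyc uc nc.
(* The cycle is unrolled to an [n]-periodic sequence, as [square_cycle_sun] expects. *)
pose n := size c; pose x m := nth z0 c (m %% n).
have n3 : 3 < n by [].
have n0 : 0 < n by [].
have xc m : x m \in c by rewrite mem_nth // ltn_mod.
have x_eq a b : x a = x b -> a = b %[mod n].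
  by move/eqP; rewrite nth_uniq ?ltn_mod // => /eqP.
have xS m : next c (x m) = x m.+1.
  rewrite next_nth xc /c -/c index_uniq ?ltn_mod // /x -addn1 -modnDml addn1.
  have : m %% n < n by rewrite ltn_mod.
  rewrite leq_eqVlt => /orP[/eqP mn|mn].
    by rewrite mn modnn nth_default // -ltnS -[(size p).+1]/n mn.
  by rewrite (modn_small mn).
have chordless i j : F (x i) (x j) -> x j = x i.+1 \/ x i = x j.+1.
  move=> Fij; have /exists_inPn/(_ _ (xc i))/exists_inPn/(_ _ (xc j)) := nc.
  by rewrite Fij !xS /= negb_and !negbK => /orP[/eqP|/eqP]; [left | right].
have x_inj i m : 0 < m < n -> x i != x (i + m).
  case/andP=> m0 mn; apply/eqP => /x_eq/eqP.
  by rewrite -{1}[i]addn0 eqn_modDl mod0n modn_small // eq_sym -[_ == _]negbK -lt0n m0.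
apply: (@square_cycle_sun T e n x) => //.
- by move=> i; rewrite /x modnDr.
- by move=> i; have /andP[] := next_cycle cyc (xc i); rewrite xS.
move=> i m mn dist2; have Fx : F (x i) (x (i + m)) by rewrite /F x_inj.
have [m0 mn'] := andP mn.
have [|] := chordless _ _ Fx => /x_eq/eqP.
  by rewrite -addn1 eqn_modDl (modn_small mn') (modn_small (ltnW (ltnW n3))) => /eqP; left.
rewrite -addnS -{1}[i]addn0 eqn_modDl mod0n => m1; right; move: m1.
have [<- //|mn''] := eqVneq m.+1 n.
have lt : m.+1 < n by rewrite ltn_neqAle mn''.
by rewrite modn_small.
Qed.

(** * Powers of sun-free chordal graphs *)

Lemma connected_ball (T : finType) (e : rel T) (R : rel T) r v :
  (forall x y, e x y -> R x y) -> symmetric R ->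
  connected_set R [set x | dist_le e r v x].
Proof.
move=> eR R_sym B /subsetP BA B0 BnA.
have cross (X : {set T}) p w : path e w p -> w \in X -> last w p \notin X ->
    exists q a, [/\ path e w (rcons q a), size q < size p,
                    last w q \in X & a \notin X].
  elim: p w => [|a p IH] w /=; first by move=> _ ->.
  case/andP=> wa ep wX lX; have [aX|aX] := boolP (a \in X).
    have [q [b [eq sq lq bX]]] := IH a ep aX lX.
    by exists (a :: q), b; rewrite /= wa.
  by exists [::], a; rewrite /= wa.
(* A walk of length at most [r] from the centre stays in the ball and crosses every cut between its
   ends. It is used for [B] or its complement, whichever contains [v]. *)
have ball_cross (X : {set T}) z : v \in X -> dist_le e r v z -> z \notin X ->
    exists a b, [/\ a \in X, b \notin X, dist_le e r v a, dist_le e r v b & e a b].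
  move=> vX /dist_leP[p [ep lp sp]]; rewrite -lp => zX.
  have [q [b [+ sq aX bX]]] := cross X p v ep vX zX.
  rewrite rcons_path => /andP[eq eb]; exists (last v q), b; split=> //.
    by apply/dist_leP; exists q; split=> //; apply: ltnW (leq_trans sq sp).
  apply/dist_leP; exists (rcons q b).
  by rewrite rcons_path eq eb last_rcons size_rcons (leq_trans sq sp).
have [vB|vB] := boolP (v \in B).
  have [z zA zB] : exists2 z, z \in [set x | dist_le e r v x] & z \notin B.
    apply/subsetPn; apply: contraNN BnA => AB; rewrite eqEsubset AB andbT.
    exact/subsetP.
  have [|a [b [aB bB _ vb eab]]] := ball_cross B z vB _ zB.
    by rewrite inE in zA.
  by exists a, b; rewrite !inE bB vb; split=> //; apply: eR.
have /set0Pn[z zB] := B0.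
have [|||a [b [aB bB va _ eab]]] := ball_cross (~: B) z; rewrite ?inE //.
- by have := BA z zB; rewrite inE.
- by rewrite negbK.
move: aB bB; rewrite !inE negbK => aB bB.
by exists b, a; rewrite !inE aB va; split=> //; rewrite R_sym; apply: eR.
Qed.

Lemma eq_has_simplicial (T : finType) (R R' : rel T) :
  R =2 R' -> has_simplicial R -> has_simplicial R'.
Proof.
move=> RR' simp W /simp[s sW sP]; exists s => // a b aW bW.
by rewrite -!RR'; apply: sP.
Qed.

(* [d(u,v) <= 2 j + r] holds iff the balls of radius [j] around [u] and [v]
   touch in the [r]-th power of the graph. *)
Lemma power_has_simplicial (T : finType) (e : rel T) r j :
  symmetric e -> 0 < r -> has_simplicial (dist_le e r) ->
  has_simplicial (dist_le e (j + r + j)).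
Proof.
move=> e_sym r0 simp.
apply: (@eq_has_simplicial _ (fun u v => touch (dist_le e r)
  [set x | dist_le e j u x] [set x | dist_le e j v x])) => [u v|].
  apply/touchP/dist_leD => [[a [b []]]|[b /dist_leD[a ua ab] bv]].
    rewrite !inE => ua vb ab; exists b; last by rewrite dist_le_sym.
    by apply/dist_leD; exists a.
  by exists a, b; rewrite !inE ua dist_le_sym.
apply: touch_has_simplicial => //.
- exact: dist_le_refl.
- exact: dist_le_sym.
- by move=> u; apply/set0Pn; exists u; rewrite inE dist_le_refl.
move=> u; apply: connected_ball; last exact: dist_le_sym.
by move=> x y xy; apply: dist_leW r0 _; rewrite dist_le1 xy orbT.
Qed.

Lemma sun_free_power_has_simplicial (T : finType) (e : rel T) k :
  symmetric e -> irreflexive e -> sun_free_chordal e -> 0 < k ->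
  has_simplicial (dist_le e k).
Proof.
move=> e_sym e_irr e_sfc k0.
have [|odd_k] := boolP (odd k).
  move=> odd_k; rewrite -[k]odd_double_half odd_k addnC -addnn addnAC.
  apply: power_has_simplicial => //.
  apply: eq_has_simplicial (chordal_has_simplicial e_sym e_irr (proj1 e_sfc)) => x y.
  by rewrite dist_le1.
(* Here [k] is even and positive, so [k./2] is at least 1. *)
have -> : k = k./2.-1 + 2 + k./2.-1 by lia.
apply: power_has_simplicial => //.
have F_sym : symmetric (fun a b => (a != b) && dist_le e 2 a b).
  by move=> a b; rewrite eq_sym dist_le_sym.
have F_irr : irreflexive (fun a b => (a != b) && dist_le e 2 a b).
  by move=> a; rewrite eqxx.
have F_ch := chordal_square e_sym e_irr e_sfc.
apply: eq_has_simplicial (chordal_has_simplicial F_sym F_irr F_ch) => x y /=.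
by case: eqVneq => //= ->; rewrite dist_le_refl.
Qed.

Theorem theorem5 (T : finType) (e : rel T)
    (e_sym : symmetric e) (e_irr : irreflexive e)
    (e_sfc : sun_free_chordal e) (k : nat) (k_gt0 : 0 < k) :
  gamma e k = rho e k <-> rho e k = rho e (2 * k).
Proof.
have le1 := gamma_le_rho k e_sym; have le2 := rho_double_le_gamma k e_sym.
split=> [gr|rr]; apply/eqP; rewrite eqn_leq.
  rewrite (leq_trans le2 le1) andbT; apply: rho_double_ge => //.
  exact: sun_free_power_has_simplicial.
by rewrite le1 rr.
Qed.
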